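(* Let $P\subseteq\mathbb{Z}^2$ be a set of four points in strictly nonconvex position. Then there is a constant $c=c_P>0$ such that for every $0<\alpha<1/2$ and all sufficiently large $N$ (depending on $\alpha$ and $P$), there exists $A\subseteq[N]^2$ with $|A|\ge\alpha N^2$ such that for all nonzero integers $d$, there are at most $\alpha^{c\log(1/\alpha)}N^2$ points $x\in\mathbb{Z}^2$ with $x+d\cdot P\subseteq A$.
   Context: $[N]=\{1,\dots,N\}$ and $x+d\cdot P=\{x+dt:t\in P\}$. Four points are in strictly nonconvex position if no three of them are collinear and one of them lies in the interior of the triangle formed by the other three. *)

(* Defs.v *)
From mathcomp Require Import all_boot all_order all_algebra finmap.
From mathcomp Require Import all_classical all_reals all_analysis.

Set Implicit Arguments.
Unset Strict Implicit.
Unset Printing Implicit Defensive.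

Import Order.TTheory GRing.Theory Num.Theory.
Import numFieldNormedType.Exports.

Local Open Scope classical_set_scope.
Local Open Scope ring_scope.

Definition toplane (R : realType) (p : int * int) : R * R :=
  (p.1%:~R, p.2%:~R).

Definition collinear (R : realType) (p q r : R * R) : Prop :=
  exists u v w : R, (u, v) != (0, 0) /\
    forall x : R * R, x = p \/ x = q \/ x = r -> u * x.1 + v * x.2 = w.

Definition triangle (R : realType) (p q r : R * R) : set (R * R) :=
  [set x | exists a b c : R,
    [/\ 0 <= a, 0 <= b, 0 <= c, a + b + c = 1 &
        x = (a * p.1 + b * q.1 + c * r.1, a * p.2 + b * q.2 + c * r.2)]].

Definition strictly_nonconvex (R : realType) (P : {fset int * int}) : Prop :=
  [/\ #|` P| = 4%N,
      forall p q r : int * int, p \in P -> q \in P -> r \in P ->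
        p != q -> p != r -> q != r ->
        ~ collinear (toplane R p) (toplane R q) (toplane R r)
    & exists p q r s : int * int, P = [fset p; q; r; s]%fset /\
        interior (triangle (toplane R p) (toplane R q) (toplane R r))
          (toplane R s)].

Definition grid (N : nat) : set (int * int) :=
  [set x | (1 <= x.1 <= N%:Z) && (1 <= x.2 <= N%:Z)].

Definition dilate (x : int * int) (d : int) (P : {fset int * int}) :
    set (int * int) :=
  [set (x.1 + d * t.1, x.2 + d * t.2) | t in [set` P]].

(* Main.v *)
Require Import Defs.
From mathcomp Require Import all_boot all_order all_algebra finmap.
From mathcomp Require Import all_classical all_reals all_analysis.
From mathcomp Require Import zify ring lra.

(** Write the interior point [s] of the pattern as a convex combination of the
    other three, [a1 v1 + a2 v2 + a3 v3 = 0] with [vi := pi - s] and positive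
    integers [ai].  Some nonzero quadratic form [f] satisfies
    [a1 f(v1) + a2 f(v2) + a3 f(v3) = 0], and then for all [y] and [d]
      [a1 f(y + d v1) + a2 f(y + d v2) + a3 f(y + d v3) = (a1 + a2 + a3) f(y)].
    Let [A] be the set of [y] for which [f(y) + t] modulo [M], with [M] slightly
    larger than [N], lies in a union of short intervals of length about [M / L]
    placed at the points of a Behrend-type set for this convex equation.  A
    pattern in [A] puts its four values in the same interval, so the affine form
    [f(y + d v2) - f(y)] is within [O(M / L)] of [0] modulo [M].  As [M] has no
    small factor, this happens for [O(N^2 / L)] points [y] whatever [d <> 0]
    is, while the density [alpha] of [A] is only [exp (- O(sqrt (log L)))].
    An averaging argument picks the shift [t]. *)

Import Order.TTheory GRing.Theory Num.Theory.
Import numFieldNormedType.Exports.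

(** * Digit expansions and a Behrend-type set for a convex equation *)

Lemma exists_ge_average (I : finType) (F : I -> nat) :
  0 < #|I| -> exists i, \sum_j F j <= #|I| * F i.
Proof.
case/card_gt0P=> i0 _; case: (arg_maxnP F (isT : predT i0)) => i _ maxF.
by exists i; rewrite -sum_nat_const; apply: leq_sum => j _; apply: maxF.
Qed.

Lemma digits_lt (b n : nat) (f : 'I_n -> nat) :
  (forall i, f i < b) -> \sum_(i < n) f i * b ^ i < b ^ n.
Proof.
elim: n f => [|n IH] f fb; first by rewrite big_ord0.
rewrite big_ord_recr /= expnS.
have := IH (fun i => f (widen_ord (leqnSn n) i)) (fun i => fb _).
have := fb ord_max; move: (f ord_max) (\sum_(i < n) _) (b ^ n) => x y z; nia.
Qed.

Lemma digits_inj (b n : nat) (f g : 'I_n -> nat) :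
  (forall i, f i < b) -> (forall i, g i < b) ->
  \sum_(i < n) f i * b ^ i = \sum_(i < n) g i * b ^ i -> f =1 g.
Proof.
elim: n f g => [|n IH] f g fb gb E; first by case.
have step (h : 'I_n.+1 -> nat) :
    \sum_(i < n.+1) h i * b ^ i =
    (\sum_(i < n) h (lift ord0 i) * b ^ i) * b + h ord0.
  rewrite big_ord_recl expn0 muln1 addnC big_distrl /=; congr addn.
  by apply: eq_bigr => i _; rewrite /bump /= add1n expnSr mulnA.
have b0 : 0 < b by exact: leq_ltn_trans (fb ord0).
move: E; rewrite !step => E.
have E0 : f ord0 = g ord0.
  by have := congr1 (modn^~ b) E; rewrite !modnMDl !modn_small.
have E1 := congr1 (divn^~ b) E; move: E1.
rewrite !divnMDl // !divn_small // !addn0 => /(IH _ _ (fun i => fb _) (fun i => gb _)) E1.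
by move=> i; case: (unliftP ord0 i) => [j ->|-> //]; apply: E1.
Qed.

(** In each coordinate [x0] is the weighted mean of [x1], [x2], [x3], so the weighted sum of the
    squares equals [a0 x0^2], with [a0 = a1 + a2 + a3], plus the weighted sum of the squared
    deviations from [x0]. Summing over coordinates, the equal norms cancel and the deviations
    vanish. *)
Lemma sphere_strictly_convex (n a1 a2 a3 rho : nat) (x0 x1 x2 x3 : 'I_n -> nat) :
  0 < a2 ->
  \sum_i x0 i ^ 2 = rho -> \sum_i x1 i ^ 2 = rho ->
  \sum_i x2 i ^ 2 = rho -> \sum_i x3 i ^ 2 = rho ->
  (forall i, a1 * x1 i + a2 * x2 i + a3 * x3 i = (a1 + a2 + a3) * x0 i) ->
  x2 =1 x0.
Proof.
move=> a2_gt0 h0 h1 h2 h3 E.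
pose dev (x : 'I_n -> nat) i := (`|x i - x0 i|%N ^ 2)%N.
have pt i : a1 * dev x1 i + a2 * dev x2 i + a3 * dev x3 i +
    (a1 + a2 + a3) * x0 i ^ 2 =
    a1 * x1 i ^ 2 + a2 * x2 i ^ 2 + a3 * x3 i ^ 2.
  move: (E i); rewrite /dev; move: (x0 i) (x1 i) (x2 i) (x3 i) => y0 y1 y2 y3 e.
  have e' : (a1%:Z * y1%:Z + a2%:Z * y2%:Z + a3%:Z * y3%:Z =
    (a1%:Z + a2%:Z + a3%:Z) * y0%:Z)%R by rewrite -!PoszM -!PoszD e.
  have sq (u v : nat) :
      ((`|u - v|%N)%:Z * (`|u - v|%N)%:Z = (u%:Z - v%:Z) * (u%:Z - v%:Z))%R.
    by rewrite -PoszM -abszM gez0_abs // -expr2 sqr_ge0.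
  apply/eqP; rewrite -eqz_nat; apply/eqP.
  rewrite -!mulnn !(PoszD, PoszM) !sq.
  transitivity (a1%:Z * (y1%:Z * y1%:Z) + a2%:Z * (y2%:Z * y2%:Z) +
    a3%:Z * (y3%:Z * y3%:Z) + 2 * y0%:Z * ((a1%:Z + a2%:Z + a3%:Z) * y0%:Z -
      (a1%:Z * y1%:Z + a2%:Z * y2%:Z + a3%:Z * y3%:Z)))%R.
    by ring.
  by rewrite e' subrr mulr0 addr0.
have tot : \sum_i a2 * dev x2 i == 0.
  have : \sum_i (a1 * dev x1 i + a2 * dev x2 i + a3 * dev x3 i +
      (a1 + a2 + a3) * x0 i ^ 2) =
    \sum_i (a1 * x1 i ^ 2 + a2 * x2 i ^ 2 + a3 * x3 i ^ 2).
    by apply: eq_bigr => i _; apply: pt.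
  rewrite !big_split /= -!big_distrr /= h0 h1 h2 h3.
  lia.
move=> i; move: tot; rewrite sum_nat_eq0 => /forallP/(_ i) /=.
rewrite /dev; nia.
Qed.

(** Behrend's construction: take the most popular sphere in the box [[0, m)^n], [m = 4^n], and read
    its points as digits in base [b = a0 m]. In this base the two sides of the equation have no
    carries, so it holds digit by digit and strict convexity of the sphere applies. There are at
    most [n m^2 <= 32^n] norms, and the enlarged base costs a further [a0^n]. *)
Lemma behrend (n a1 a2 a3 : nat) :
  0 < n -> 0 < a2 ->
  let a0 := a1 + a2 + a3 in let L := (a0 * 4 ^ n) ^ n in
  exists Lam : {set 'I_L},
    L <= #|Lam| * (32 * a0) ^ n /\
    forall x0 x1 x2 x3, x0 \in Lam -> x1 \in Lam -> x2 \in Lam -> x3 \in Lam ->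
      a1 * x1 + a2 * x2 + a3 * x3 = a0 * x0 -> x2 = x0.
Proof.
move=> n_gt0 a2_gt0 a0 L.
set m := 4 ^ n; set b := a0 * m.
have a0_gt0 : 0 < a0 by rewrite /a0; lia.
have m_gt0 : 0 < m by rewrite expn_gt0.
have mb : m <= b by rewrite leq_pmull.
pose pt : finType := {ffun 'I_n -> 'I_m}.
have codeP (x : pt) : \sum_(i < n) x i * b ^ i < L.
  by apply: (@digits_lt b n (fun i => x i)) => i; apply: leq_trans (ltn_ord _) mb.
pose code (x : pt) : 'I_L := Ordinal (codeP x).
have normP (x : pt) : \sum_(i < n) x i ^ 2 < n * m ^ 2.
  apply: (@leq_ltn_trans (\sum_(i < n) m.-1 ^ 2)).
    by apply: leq_sum => i _; rewrite leq_sqr -ltnS prednK.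
  by rewrite sum_nat_const card_ord ltn_mul2l n_gt0 ltn_sqr ltn_predL.
pose norm (x : pt) : 'I_(n * m ^ 2) := Ordinal (normP x).
have [|rho] := @exists_ge_average 'I_(n * m ^ 2) (fun j => #|[set x | norm x == j]|).
  by rewrite card_ord muln_gt0 n_gt0 expn_gt0 m_gt0.
have -> : \sum_j #|[set x | norm x == j]| = m ^ n.
  transitivity (\sum_(x : pt) 1).
    rewrite (partition_big norm predT) //=; apply: eq_bigr => j _.
    by rewrite -sum1_card; apply: eq_bigl => x; rewrite inE.
  by rewrite sum1_card card_ffun !card_ord.
rewrite card_ord => card_sphere.
have code_inj : injective code.
  move=> x y /(congr1 val) /= E; apply/ffunP => i; apply/val_inj.
  by apply: (@digits_inj b n (fun i => x i) (fun i => y i)) E i => j;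
    apply: leq_trans (ltn_ord _) mb.
exists (code @: [set x | norm x == rho]); split.
  rewrite card_imset // /L expnMn.
  set S := #|_| in card_sphere *.
  have n2 : n <= 2 ^ n by apply/ltnW/ltn_expl.
  have -> : (32 * a0) ^ n = a0 ^ n * (2 ^ n * m ^ 2).
    have -> : 32 * a0 = a0 * (2 * 4 ^ 2) by rewrite mulnC.
    by rewrite !expnMn /m mulnn.
  rewrite mulnCA leq_mul2l; apply/orP; right; apply: leq_trans card_sphere _.
  by rewrite mulnC leq_mul2l leq_mul2r n2 !orbT.
move=> _ _ _ _ /imsetP[x0 + ->] /imsetP[x1 + ->] /imsetP[x2 + ->] /imsetP[x3 + ->].
rewrite !inE => /eqP/(congr1 val)/= h0 /eqP/(congr1 val)/= h1.
move=> /eqP/(congr1 val)/= h2 /eqP/(congr1 val)/= h3 E.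
congr code; apply/ffunP => i; apply/val_inj => /=.
apply: (@sphere_strictly_convex n a1 a2 a3 (rho : nat) (fun i => x0 i)
  (fun i => x1 i) (fun i => x2 i) (fun i => x3 i)) => // {i}.
apply: (@digits_inj b) => [i|i|].
- rewrite /b /a0; move: (ltn_ord (x1 i)) (ltn_ord (x2 i)) (ltn_ord (x3 i)).
  by clear -a2_gt0; move: (nat_of_ord (x1 i)) (nat_of_ord (x2 i)) (nat_of_ord (x3 i)) => ? ? ?; nia.
- by rewrite ltn_pmul2l.
move: E; rewrite !big_distrr /= -!big_split /= => E.
by under eq_bigr do rewrite !mulnDl -!mulnA; rewrite E; apply: eq_bigr => i _; rewrite mulnA.
Qed.

(** * Residues modulo [M]: affine forms and averaging over shifts *)

(** As [k] divides [W!], the gcd is that of [d] and [M], which is at most [d < M]. Its cofactor in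
    [M] exceeds 1 and is prime to [W!], hence is at least [W]. *)
Lemma gcdn_mul_fact_coprime (M W k d : nat) :
  coprime M W`! -> 0 < k <= W -> 0 < d < M -> gcdn (k * d) M * W <= M.
Proof.
move=> coMW kW /andP[d_gt0 dM].
have coMk : coprime M k by apply: coprime_dvdr coMW; rewrite dvdn_fact.
rewrite gcdnC Gauss_gcdr //; set g := gcdn M d.
have g_gt0 : 0 < g by rewrite gcdn_gt0 d_gt0 orbT.
have gd : g <= d by rewrite dvdn_leq // dvdn_gcdr.
have /dvdnP[q Mq] : g %| M by exact: dvdn_gcdl.
rewrite [X in _ <= X]Mq mulnC leq_mul2r; apply/orP; right.
rewrite leqNgt; apply/negP => qW.
have q_gt1 : 1 < q by nia.
have qF : q %| W`! by apply: dvdn_fact; rewrite (ltnW q_gt1) ltnW.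
have : q %| gcdn M W`! by rewrite dvdn_gcd qF andbT Mq dvdn_mulr.
by rewrite (eqP coMW) dvdn1 => /eqP q1; rewrite q1 in q_gt1.
Qed.


Definition residue (M : nat) (z : int) : nat := `|(z %% M)%Z|%N.

Lemma residueE (M : nat) (z : int) : 0 < M ->
  exists t : int, z = ((residue M z)%:Z + t * M%:Z)%R.
Proof.
move=> M_gt0; exists (z %/ M)%Z; rewrite gez0_abs; last first.
  by rewrite modz_ge0 // eqz_nat -lt0n.
by rewrite addrC -divz_eq.
Qed.

Lemma ltn_residue (M : nat) (z : int) : 0 < M -> residue M z < M.
Proof.
move=> M_gt0; rewrite -ltz_nat gez0_abs; last first.
  by rewrite modz_ge0 // eqz_nat -lt0n.
by rewrite ltz_pmod.
Qed.

Lemma residue_small (M r : nat) (t : int) :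
  r < M -> residue M (r%:Z + t * M%:Z)%R = r.
Proof. by move=> rM; rewrite /residue addrC modzMDl modz_nat modn_small. Qed.

Lemma residue_eq_dvd (M : nat) (y z : int) : 0 < M ->
  residue M y = residue M z -> M %| `|(y - z)%R|%N.
Proof.
move=> M_gt0 E; have [t ->] := residueE M y M_gt0; have [u ->] := residueE M z M_gt0.
rewrite E; apply/dvdnP; exists `|(t - u)%R|%N.
by rewrite -[in RHS](absz_nat M) -abszM; congr absz; ring.
Qed.

(** Let [g] be the gcd and [q = M / g]. All the residues lie in one class modulo [g], and a residue
    determines [y] modulo [q]. So [y] is determined by [y %/ q], with at most [g] values since
    [N <= M], and by the residue divided by [g], with at most [h %/ g + 1] values. *)
Lemma card_affine_residue_lt (N M h : nat) (k c : int) :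
  0 < M -> N <= M ->
  #|[set y : 'I_N | residue M (k * y.+1%:Z + c)%R < h]%SET| <=
    h + gcdn `|k|%N M.
Proof.
move=> M_gt0 NM; set g := gcdn _ _.
have g_gt0 : 0 < g by rewrite gcdn_gt0 M_gt0 orbT.
have /dvdnP[q Mq] : g %| M by exact: dvdn_gcdr.
have /dvdnP[k' kq] : g %| `|k|%N by exact: dvdn_gcdl.
have gk : g %| `|k|%N by exact: dvdn_gcdl.
have gM : g %| M by exact: dvdn_gcdr.
have q_gt0 : 0 < q by nia.
have cokq : coprime q k'.
  have : gcdn k' q * g == 1 * g by rewrite mul1n muln_gcdl -kq -Mq.
  by rewrite eqn_pmul2r // coprime_sym.
clearbody g.
pose r (y : 'I_N) := residue M (k * y.+1%:Z + c)%R.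
have rmod y z : r y = r z %[mod g].
  have [t Et] := residueE M (k * y.+1%:Z + c)%R M_gt0.
  have [u Eu] := residueE M (k * z.+1%:Z + c)%R M_gt0.
  have E : ((r y)%:Z - (r z)%:Z = k * (y.+1%:Z - z.+1%:Z) + (u - t) * M%:Z)%R.
    have -> : ((r y)%:Z = k * y.+1%:Z + c - t * M%:Z)%R by rewrite [in RHS]Et addrK.
    have -> : ((r z)%:Z = k * z.+1%:Z + c - u * M%:Z)%R by rewrite [in RHS]Eu addrK.
    by ring.
  apply/eqP; rewrite -eqz_nat -!modz_nat eqz_mod_dvd E rpredD //.
    by apply: dvdz_mulr.
  by apply: dvdz_mull.
have lt1 (y : 'I_N) : y %/ q < g.
  by rewrite ltn_divLR // mulnC -Mq; apply: leq_trans NM.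
(* The [minn] only makes the map total: it does nothing when the residue is below [h]. *)
have lt2 (y : 'I_N) : minn (r y %/ g) (h %/ g) < (h %/ g).+1.
  by rewrite ltnS geq_minr.
pose f y : 'I_g * 'I_(h %/ g).+1 := (Ordinal (lt1 y), Ordinal (lt2 y)).
have /(leq_card_in f) : {in [set y : 'I_N | r y < h]%SET &, injective f}.
  move=> y z; rewrite !inE => ry rz [E1 E2].
  have E3 : r y %/ g = r z %/ g.
    by move: E2; rewrite !(minn_idPl _) // leq_div2r // ltnW.
  have E4 : r y = r z by rewrite (divn_eq (r y) g) E3 (rmod y z) -divn_eq.
  have := residue_eq_dvd M _ _ M_gt0 E4.
  have -> : (k * y.+1%:Z + c - (k * z.+1%:Z + c) = k * (y%:Z - z%:Z))%R.
    by rewrite !intS; ring.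
  rewrite abszM kq Mq mulnAC dvdn_pmul2r // Gauss_dvdr // => dq.
  apply/val_inj => /=; rewrite (divn_eq y q) (divn_eq z q) E1; congr addn.
  apply/eqP; rewrite -eqz_nat -!modz_nat eqz_mod_dvd; exact: dq.
rewrite card_prod !card_ord => /leq_trans-> //.
by rewrite mulnS addnC leq_add2r mulnC leq_divM.
Qed.

(** For fixed [y], [q y + t] meets every residue exactly once as [t] runs through ['I_M]. Counting
    pairs [(y, t)] both ways gives the average over [t], and some shift reaches it. *)
Lemma exists_dense_shift (T : finType) (M : nat) (q : T -> int) (U : pred nat) :
  0 < M -> exists t : nat,
    #|T| * #|[set u : 'I_M | U u]%SET| <=
      M * #|[set y : T | U (residue M (q y + t%:Z)%R)]%SET|.
Proof.
move=> M_gt0.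
have shift (c : int) : #|[set t : 'I_M | U (residue M (c + t%:Z)%R)]%SET| =
    #|[set u : 'I_M | U u]%SET|.
  pose f (t : 'I_M) : 'I_M := Ordinal (ltn_residue M (c + t%:Z)%R M_gt0).
  rewrite -(@card_preimset _ f [set u : 'I_M | U u]%SET); first by apply: eq_card => t; rewrite !inE.
  move=> t t' /(congr1 val)/(residue_eq_dvd M _ _ M_gt0).
  move: (ltn_ord t) (ltn_ord t'); case: (posnP `|(c + t%:Z - (c + t'%:Z))%R|%N).
    by move=> E ? ? _; apply/val_inj => /=; lia.
  by move=> E ? ? /dvdn_leq; lia.
have [|t] := @exists_ge_average 'I_M
  (fun t => #|[set y : T | U (residue M (q y + t%:Z)%R)]%SET|).
  by rewrite card_ord.
rewrite card_ord => le_avg; exists t; apply: leq_trans le_avg.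
have cardE (S : finType) (P : pred S) : #|[set x | P x]%SET| = \sum_x P x.
  by rewrite -sum1dep_card big_mkcond; apply: eq_bigr => x _; case: (P x).
under [leqRHS]eq_bigr do rewrite cardE.
rewrite exchange_big /=.
under [leqRHS]eq_bigr do rewrite -(cardE 'I_M) shift.
by rewrite sum_nat_const.
Qed.

(** * Unions of short blocks *)

(** The union of the intervals [[l s, l s + w)] for [l] in [Lam]. *)
Definition in_blocks (L : nat) (Lam : {set 'I_L}) (s w u : nat) : bool :=
  (u %% s < w) && [exists l in Lam, nat_of_ord l == u %/ s].

Lemma in_blocksP (L : nat) (Lam : {set 'I_L}) (s w u : nat) :
  in_blocks L Lam s w u ->
  exists2 l, l \in Lam & exists2 e, e < w & u = l * s + e.
Proof.
case/andP=> uw /existsP[l /andP[lL /eqP lE]].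
by exists l => //; exists (u %% s) => //; rewrite lE -divn_eq.
Qed.

Lemma card_in_blocks (L M : nat) (Lam : {set 'I_L}) (s w : nat) :
  w <= s -> L * s <= M ->
  #|Lam| * w <= #|[set u : 'I_M | in_blocks L Lam s w u]%SET|.
Proof.
move=> ws LsM.
have ltM (p : 'I_L * 'I_w) : p.1 * s + p.2 < M.
  by have := ltn_ord p.1; have := ltn_ord p.2; nia.
pose f p : 'I_M := Ordinal (ltM p).
have small (p : 'I_L * 'I_w) : p.2 < s by apply: leq_trans (ltn_ord _) ws.
have divf p : f p %/ s = p.1.
  have := small p; move=> p2s.
  by rewrite /= divnMDl ?divn_small ?addn0 //; apply: leq_ltn_trans p2s.
have modf p : f p %% s = p.2 by rewrite /= modnMDl modn_small.
have f_inj : injective f.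
  move=> p p' E; rewrite (surjective_pairing p) (surjective_pairing p').
  by congr pair; apply/val_inj; rewrite /= -?divf -?modf E.
rewrite -{1}(card_ord w) -cardsT -cardsX -(card_imset _ f_inj).
apply/subset_leq_card/fintype.subsetP => _ /imsetP[p + ->].
rewrite !inE andbT => pL; rewrite /in_blocks modf divf ltn_ord /=.
by apply/existsP; exists p.1; rewrite pL eqxx.
Qed.

(** With spacing [s = a0 w], the weighted offsets inside the blocks add up to less than [s] on both
    sides. Division by [s] therefore leaves the same equation for the block indices, which forces
    [u0] and [u2] into one block of length [w]. *)
Lemma in_blocks_close (L : nat) (Lam : {set 'I_L}) (a1 a2 a3 w : nat)
    (u0 u1 u2 u3 : nat) :
  let a0 := a1 + a2 + a3 in
  0 < a0 ->
  (forall x0 x1 x2 x3, x0 \in Lam -> x1 \in Lam -> x2 \in Lam -> x3 \in Lam ->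
      a1 * x1 + a2 * x2 + a3 * x3 = a0 * x0 -> x2 = x0) ->
  in_blocks L Lam (a0 * w) w u0 -> in_blocks L Lam (a0 * w) w u1 ->
  in_blocks L Lam (a0 * w) w u2 -> in_blocks L Lam (a0 * w) w u3 ->
  a1 * u1 + a2 * u2 + a3 * u3 = a0 * u0 ->
  (u2 < u0 + w) && (u0 < u2 + w).
Proof.
move=> a0 a0_gt0 LamP /in_blocksP[l0 L0 [e0 w0 E0]] /in_blocksP[l1 L1 [e1 w1 E1]].
move=> /in_blocksP[l2 L2 [e2 w2 E2]] /in_blocksP[l3 L3 [e3 w3 E3]] E.
suff /(LamP _ _ _ _ L0 L1 L2 L3) l20 : a1 * l1 + a2 * l2 + a3 * l3 = a0 * l0.
  by rewrite E0 E2 l20; apply/andP; split; lia.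
set s := a0 * w in E0 E1 E2 E3.
have se : a1 * e1 + a2 * e2 + a3 * e3 < s by rewrite /s /a0; nia.
have s0 : a0 * e0 < s by rewrite ltn_pmul2l.
have s_gt0 : 0 < s by exact: leq_ltn_trans s0.
have : (a1 * l1 + a2 * l2 + a3 * l3) * s + (a1 * e1 + a2 * e2 + a3 * e3) =
    (a0 * l0) * s + a0 * e0.
  by move: E; rewrite E0 E1 E2 E3; lia.
move/(congr1 (divn^~ s)); rewrite !divnMDl // !divn_small // !addn0 //.
Qed.

(** * Dense subsets of the grid with few patterns *)

Definition grid_point (N : nat) (y : 'I_N * 'I_N) : int * int :=
  ((y.1).+1%:Z, (y.2).+1%:Z)%R.

Definition shifted (y : int * int) (d : int) (v : int * int) : int * int :=
  (y.1 + d * v.1, y.2 + d * v.2)%R.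

Lemma card_affine_form_residue_lt (N M h : nat) (k1 k2 c : int) :
  0 < M -> N <= M ->
  #|[set y : 'I_N * 'I_N | residue M
       (k1 * (grid_point N y).1 + k2 * (grid_point N y).2 + c)%R < h]%SET| <=
    N * (h + gcdn `|k1|%N M).
Proof.
move=> M_gt0 NM.
rewrite -sum1dep_card -(pair_big_dep predT (fun i j : 'I_N => residue M
  (k1 * i.+1%:Z + k2 * j.+1%:Z + c)%R < h) (fun _ _ => 1)) /=.
rewrite (exchange_big_dep predT) //=.
rewrite -[X in X * _](card_ord N) -sum_nat_const; apply: leq_sum => j _.
rewrite sum1dep_card.
apply: leq_trans (card_affine_residue_lt N M h k1 (k2 * j.+1%:Z + c)%R M_gt0 NM).
by apply/eq_leq/eq_card => i; rewrite !inE addrA.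
Qed.

(** [q_rel] turns a pattern into a solution of the convex equation, and [q_diff] turns the closeness
    of two of its values into an affine condition on the base point. That [k1] is nonzero controls
    the gcd in the count of this condition; that [v2.2] is nonzero excludes large [d]. *)
Lemma dense_set_few_patterns (a1 a2 a3 L : nat) (Lam : {set 'I_L})
    (q : int * int -> int) (v1 v2 v3 : int * int) (k1 k2 : int) :
  let a0 := a1 + a2 + a3 in
  0 < a1 -> 0 < a2 -> 0 < L ->
  (forall x0 x1 x2 x3, x0 \in Lam -> x1 \in Lam -> x2 \in Lam -> x3 \in Lam ->
      a1 * x1 + a2 * x2 + a3 * x3 = a0 * x0 -> x2 = x0) ->
  (forall y d, a1%:Z * q (shifted y d v1) + a2%:Z * q (shifted y d v2) +
     a3%:Z * q (shifted y d v3) = a0%:Z * q y)%R ->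
  (forall y d, q (shifted y d v2) - q y = d * (k1 * y.1 + k2 * y.2))%R ->
  k1 != 0%R -> v2.2 != 0%R ->
  exists N0, forall N, N0 <= N -> exists S : {set 'I_N * 'I_N},
    #|Lam| * N ^ 2 <= #|S| * (2 * a0 ^ 2 * L) /\
    forall d : int, d != 0%R -> exists T : {set 'I_N * 'I_N},
      #|T| * L <= 4 * N ^ 2 /\
      forall y0 y1 y2 y3, y0 \in S -> y1 \in S -> y2 \in S -> y3 \in S ->
        grid_point N y1 = shifted (grid_point N y0) d v1 ->
        grid_point N y2 = shifted (grid_point N y0) d v2 ->
        grid_point N y3 = shifted (grid_point N y0) d v3 -> y0 \in T.
Proof.
move=> a0 a1_gt0 a2_gt0 L_gt0 LamP q_rel q_diff k1_neq0 v2_neq0.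
have a0_gt1 : 1 < a0 by rewrite /a0; lia.
pose W := maxn L `|k1|%N.
have [LW kW] : L <= W /\ `|k1|%N <= W by rewrite leq_maxl leq_maxr.
clearbody W; set F := W`!; have F_gt0 : 0 < F by exact: fact_gt0.
(* The first summand gives [M <= 2 N], the second a block length [w >= 1]. *)
exists (F.+1 + a0 ^ 2 * L) => N N0N.
(* [M] is prime to every number up to [W], so multiplication by a nonzero
   [d < M] cannot collapse [Z/M] to fewer than [W] classes. *)
set M := (N %/ F).+1 * F + 1.
have coMF : coprime M F by rewrite /coprime /M gcdnC gcdnMDl gcdn1.
have NM : N < M by rewrite /M addn1 ltnS mulSn addnC {1}(divn_eq N F) leq_add2l ltnW // ltn_pmod.
have M2N : M <= 2 * N.
  have : N %/ F * F <= N by exact: leq_divM.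
  by rewrite /M mulSn; lia.
have M_gt0 : 0 < M by exact: leq_ltn_trans NM.
clearbody M; set Q := a0 ^ 2 * L; have Q_gt0 : 0 < Q by rewrite /Q; nia.
(* With [Q = a0^2 L] and [s = a0 w], the product [a0 L s = Q w] is at most [M], so weighted sums of
   values below [L s] do not wrap around. *)
set w := M %/ Q; have w_gt0 : 0 < w by rewrite divn_gt0 //; lia.
have wM : w * Q <= M by exact: leq_divM.
have Mw : M <= 2 * w * Q.
  by have := ltn_ceil M Q_gt0; move: w_gt0; rewrite -/w; clear; nia.
clearbody w; set s := a0 * w.
have a0Ls : a0 * (L * s) <= M by rewrite /s; move: wM a0_gt1; rewrite /Q -mulnn; clear; nia.
have LsM : L * s <= M by apply: leq_trans a0Ls; rewrite leq_pmull // ltnW.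
pose U := in_blocks L Lam s w.
have [t tP] := exists_dense_shift ('I_N * 'I_N)%type M (fun y => q (grid_point N y)) U M_gt0.
set S := [set y | _]%SET in tP.
exists S; split.
  have := card_in_blocks L M Lam s w (leq_pmull _ (ltnW a0_gt1)) LsM.
  move: tP; rewrite card_prod !card_ord -/U; set u := #|_|; move=> h1 h2.
  have : #|Lam| * w * N ^ 2 <= 2 * w * Q * #|S|.
    rewrite -mulnn; nia.
  move=> h3; rewrite -(leq_pmul2l w_gt0); move: h3; rewrite /Q; clear.
  by move: (a0 ^ 2) #|Lam| #|S| (N ^ 2) => *; lia.
move=> d d_neq0.
(* If [|d| >= N], the second coordinates of [y0] and [y2] would differ by at least [N], so no
   pattern fits in the grid. *)
have [dN|dN] := leqP N `|d|%N.
  exists finset.set0; rewrite cards0 mul0n; split=> // y0 y1 y2 y3 _ _ _ _ _ [_ E] _.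
  have := ltn_ord y0.2; have := ltn_ord y2.2; move: E => /= E.
  have : N <= `|(d * v2.2)%R|%N by rewrite abszM (leq_trans dN) // leq_pmulr // absz_gt0.
  lia.
(* The difference [u2 - u0] lies strictly between [-w] and [w]; adding [w] moves this window to
   residues below [2 w]. *)
exists [set y : 'I_N * 'I_N | residue M (d * k1 * (grid_point N y).1 +
   d * k2 * (grid_point N y).2 + w%:Z)%R < 2 * w]%SET.
split.
  have g_small : gcdn `|(d * k1)%R|%N M * L <= M.
    apply: leq_trans (gcdn_mul_fact_coprime M W `|k1|%N `|d|%N coMF _ _).
    - by rewrite -abszM mulrC leq_mul2l LW orbT.
    - by rewrite kW absz_gt0 k1_neq0.
    - by rewrite absz_gt0 d_neq0 (ltn_trans dN).
  have := card_affine_form_residue_lt N M (2 * w) (d * k1) (d * k2) w%:Z M_gt0 (ltnW NM).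
  set cT := #|_|; set g := gcdn _ _ in g_small *; move=> cTle.
  have wL : 2 * w * L <= M by move: wM a0_gt1; rewrite /Q; clear; nia.
  have : cT * L <= N * (2 * M) by move: cTle g_small wL; clear; nia.
  by move: M2N; clear; nia.
move=> y0 y1 y2 y3; rewrite !inE => U0 U1 U2 U3 E1 E2 E3.
rewrite E1 in U1; rewrite E2 in U2; rewrite E3 in U3.
set x := grid_point N y0 in U0 U1 U2 U3 *.
have resP z : exists b : int, (q z + t%:Z = (residue M (q z + t%:Z)%R)%:Z + b * M%:Z)%R.
  exact: residueE.
have Usmall u : U u -> u < L * s.
  case/in_blocksP => l _ [e ew ->]; apply: (@leq_trans (l.+1 * s)).
    by rewrite mulSn addnC ltn_add2r (leq_trans ew) // leq_pmull // ltnW.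
  by rewrite leq_mul2r ltn_ord orbT.
have [b0 B0] := resP x; have [b1 B1] := resP (shifted x d v1).
have [b2 B2] := resP (shifted x d v2); have [b3 B3] := resP (shifted x d v3).
move: (Usmall _ U0) (Usmall _ U1) (Usmall _ U2) (Usmall _ U3).
set u0 := residue M _ in U0 B0 *; set u1 := residue M _ in U1 B1 *.
set u2 := residue M _ in U2 B2 *; set u3 := residue M _ in U3 B3 *.
move=> lt0 lt1 lt2 lt3.
(* The shift [t] has the same total weight on both sides, so the relation survives modulo [M]. Both
   sides are below [M], which makes it an equality of natural numbers. *)
have mod_rel : (a1%:Z * u1%:Z + a2%:Z * u2%:Z + a3%:Z * u3%:Z = a0%:Z * u0%:Z +
    (a0%:Z * b0 - a1%:Z * b1 - a2%:Z * b2 - a3%:Z * b3) * M%:Z)%R.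
  have solve (p b : int) (u : nat) :
      (p + t%:Z = u%:Z + b * M%:Z -> u%:Z = p + t%:Z - b * M%:Z)%R.
    by move=> ->; rewrite addrK.
  rewrite (solve _ _ _ B0) (solve _ _ _ B1) (solve _ _ _ B2) (solve _ _ _ B3).
  have a0E : (a0%:Z = a1%:Z + a2%:Z + a3%:Z)%R by rewrite /a0 !PoszD.
  have -> : (a0%:Z * (q x + t%:Z - b0 * M%:Z) =
    a0%:Z * q x + a0%:Z * (t%:Z - b0 * M%:Z))%R by ring.
  by rewrite -(q_rel x d) a0E; ring.
have a0Lsr : a1 * (L * s) + a2 * (L * s) + a3 * (L * s) <= M by rewrite -!mulnDl.
have lt_rel : a1 * u1 + a2 * u2 + a3 * u3 < M.
  by apply: leq_trans a0Lsr; move: lt1 lt2 lt3; clear -a1_gt0; nia.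
have lt_rel0 : a0 * u0 < M by apply: leq_trans a0Ls; rewrite ltn_pmul2l // ltnW.
have rel : a1 * u1 + a2 * u2 + a3 * u3 = a0 * u0.
  rewrite -(residue_small M _ 0 lt_rel).
  rewrite -(residue_small M _ (a0%:Z * b0 - a1%:Z * b1 - a2%:Z * b2 - a3%:Z * b3)%R lt_rel0).
  by congr residue; rewrite mul0r addr0 !(PoszD, PoszM) mod_rel.
have /andP[c20 c02] := in_blocks_close L Lam a1 a2 a3 w u0 u1 u2 u3 (ltnW a0_gt1) LamP U0 U1 U2 U3 rel.
have -> : (d * k1 * x.1 + d * k2 * x.2 + w%:Z =
    (u2 + w - u0)%N%:Z + (b2 - b0) * M%:Z)%R.
  have -> : (d * k1 * x.1 + d * k2 * x.2 = q (shifted x d v2) + t%:Z - (q x + t%:Z))%R.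
    by rewrite -mulrA -mulrA -mulrDr -q_diff; ring.
  rewrite B2 B0 -subzn; last by lia.
  by rewrite PoszD; ring.
have w2M : 2 * w <= M.
  apply: leq_trans wM; rewrite mulnC leq_mul2l; apply/orP; right.
  rewrite /Q -mulnn -mulnA (leq_trans a0_gt1) // leq_pmulr //.
  by rewrite muln_gt0 L_gt0 ltnW.
by rewrite residue_small; lia.
Qed.

(** * The quadratic form and the affine relation of the pattern *)

Definition det2 (u v : int * int) : int := (u.1 * v.2 - u.2 * v.1)%R.

Definition vec (p q : int * int) : int * int := (q.1 - p.1, q.2 - p.2)%R.

(* In the coordinates of the basis [(v1, v2)], scaled by its determinant, this is
   [a2 X^2 - (a1 + a3) X Y]: among the forms annihilated by the relation between
   the [vi], the one with no [Y^2] term, so that [y |-> y + d v2] changes it by a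
   multiple of [X]. *)
Definition pattern_form (a1 a2 a3 : nat) (v1 v2 x : int * int) : int :=
  (a2%:Z * det2 x v2 ^+ 2 - (a1%:Z + a3%:Z) * det2 x v2 * det2 v1 x)%R.

(** In the expansion in [d], the linear term vanishes because the weighted sum of the [vi] is zero,
    and the quadratic term because the form satisfies the same weighted relation on the [vi]. *)
Lemma pattern_form_rel (a1 a2 a3 : nat) (v1 v2 v3 y : int * int) (d : int) :
  0 < a3 ->
  (a1%:Z * v1.1 + a2%:Z * v2.1 + a3%:Z * v3.1 = 0)%R ->
  (a1%:Z * v1.2 + a2%:Z * v2.2 + a3%:Z * v3.2 = 0)%R ->
  let f := pattern_form a1 a2 a3 v1 v2 in
  (a1%:Z * f (shifted y d v1) + a2%:Z * f (shifted y d v2) +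
     a3%:Z * f (shifted y d v3) = (a1 + a2 + a3)%N%:Z * f y)%R.
Proof.
move=> a3_gt0 h1 h2 f; rewrite !PoszD.
have a3_neq0 : (a3%:Z != 0)%R by rewrite eqz_nat -lt0n.
(* Multiplying by [a3] allows [a3 v3] to be replaced by [-(a1 v1 + a2 v2)], through the homogeneity
   stated in [G3]. *)
apply: (mulfI a3_neq0); apply/eqP; rewrite -subr_eq0; apply/eqP.
rewrite {}/f /pattern_form /det2 /shifted /=.
move: h1 h2; case: v1 v2 v3 y => [p1 p2] [q1 q2] [r1 r2] [y1 y2] /=.
move: (a1%:Z)%R (a2%:Z)%R (a3%:Z)%R => {a1 a2 a3 a3_gt0 a3_neq0} b1 b2 b3 h1 h2.
have e1 : (b3 * r1 = - (b1 * p1 + b2 * q1))%R.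
  by apply/eqP; rewrite -addr_eq0 addrC; apply/eqP.
have e2 : (b3 * r2 = - (b1 * p2 + b2 * q2))%R.
  by apply/eqP; rewrite -addr_eq0 addrC; apply/eqP.
pose X (u1 u2 : int) := (u1 * q2 - u2 * q1)%R.
pose Y (u1 u2 : int) := (p1 * u2 - p2 * u1)%R.
pose G (s t : int) := (b2 * s ^+ 2 - (b1 + b3) * s * t)%R.
have G3 : (b3 * (b3 * G (X (y1 + d * r1) (y2 + d * r2)) (Y (y1 + d * r1) (y2 + d * r2))) =
  G (b3 * X y1 y2 + d * X (b3 * r1) (b3 * r2))
    (b3 * Y y1 y2 + d * Y (b3 * r1) (b3 * r2)))%R by rewrite /G /X /Y; ring.
move: G3; rewrite e1 e2 /G /X /Y => G3.
by rewrite [(b3 * (_ + b3 * _))%R]mulrDr G3; ring.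
Qed.

Lemma pattern_form_diff (a1 a2 a3 : nat) (v1 v2 y : int * int) (d : int) :
  let f := pattern_form a1 a2 a3 v1 v2 in
  let k := ((a1%:Z + a3%:Z) * det2 v1 v2)%R in
  (f (shifted y d v2) - f y = d * (- k * v2.2 * y.1 + k * v2.1 * y.2))%R.
Proof. by rewrite /pattern_form /det2 /shifted /=; ring. Qed.

Lemma det2_eq0_collinear (R : realType) (s p q : int * int) :
  p != s -> det2 (vec s p) (vec s q) = 0%R ->
  collinear (toplane R s) (toplane R p) (toplane R q).
Proof.
move=> ps; rewrite /det2 /vec /= => /(congr1 (fun z : int => z%:~R : R)%R).
rewrite !(rmorphB, rmorphM) /= => E.
exists ((p.2 - s.2)%:~R)%R, (- (p.1 - s.1)%:~R)%R.
exists ((p.2 - s.2)%:~R * s.1%:~R - (p.1 - s.1)%:~R * s.2%:~R)%R; split.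
  apply: contra ps => /eqP[/eqP + /eqP].
  rewrite oppr_eq0 !intr_eq0 !subr_eq0 => /eqP h2 /eqP h1.
  by apply/eqP; case: p s h1 h2 {E} => [? ?] [? ?] /= -> ->.
move=> x; rewrite !rmorphB /= => -[->|[->|->]] /=; [ring|ring|].
apply/eqP; rewrite -subr_eq0; apply/eqP.
by rewrite -[RHS]oppr0 -[X in (_ = - X)%R]E; ring.
Qed.

(** The weights are twice the areas of the three triangles with apex [s], that is, the absolute
    values of the determinants [D1], [D2], [D3]. These have a common sign because they are
    proportional to the barycentric coordinates of [s]. *)
Lemma strictly_nonconvex_relation (R : realType) (P : {fset int * int}) :
  strictly_nonconvex R P ->
  exists (s p1 p2 p3 : int * int) (a1 a2 a3 : nat),
    let v1 := vec s p1 in let v2 := vec s p2 in let v3 := vec s p3 in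
    [/\ [/\ s \in P, p1 \in P, p2 \in P & p3 \in P],
        [/\ 0 < a1, 0 < a2 & 0 < a3],
        (a1%:Z * v1.1 + a2%:Z * v2.1 + a3%:Z * v3.1 = 0)%R,
        (a1%:Z * v1.2 + a2%:Z * v2.2 + a3%:Z * v3.2 = 0)%R &
        det2 v1 v2 != 0%R /\ v2.2 != 0%R].
Proof.
case=> cardP ncol [p [q [r [s [PE s_int]]]]].
have [pP qP rP sP] : [/\ p \in P, q \in P, r \in P & s \in P].
  by rewrite PE !inE !eqxx !orbT.
have /and3P[pqrs qrs rs] : [&& p \notin [:: q; r; s], q \notin [:: r; s] & r \notin [:: s]].
  have : uniq [:: p; q; r; s].
    have PE' : P = seq_fset tt [:: p; q; r; s].
      by apply/fsetP => x; rewrite PE seq_fsetE !inE -!orbA.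
    by move: cardP; rewrite PE' size_seq_fset => E; rewrite -[uniq _]negbK -ltn_size_undup E.
  by rewrite /= andbT.
move: pqrs qrs rs; rewrite !inE !negb_or => /and3P[pq pr ps] /andP[qr qs] rs.
have det_neq0 (x y : int * int) : x \in P -> y \in P -> x != s -> y != s -> x != y ->
    det2 (vec s x) (vec s y) != 0%R.
  move=> xP yP xs ys xy; apply/eqP => /(det2_eq0_collinear R s x y xs).
  by apply: ncol => //; rewrite eq_sym.
have [a [b [c [a_ge0 b_ge0 c_ge0 abc]]]] := @interior_subset _ _ _ s_int.
rewrite /toplane /= => -[E1 E2].
pose D1 := det2 (vec s q) (vec s r); pose D2 := det2 (vec s r) (vec s p).
pose D3 := det2 (vec s p) (vec s q).
have [D1_neq0 D2_neq0 D3_neq0] : [/\ D1 != 0, D2 != 0 & D3 != 0]%R.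
  by split; apply: det_neq0 => //; rewrite eq_sym.
have S1 : (a * (p.1 - s.1)%:~R + b * (q.1 - s.1)%:~R + c * (r.1 - s.1)%:~R = 0 :> R)%R.
  transitivity (a * p.1%:~R + b * q.1%:~R + c * r.1%:~R - (a + b + c) * s.1%:~R : R)%R.
    by rewrite !rmorphB /=; ring.
  by rewrite abc mul1r -E1 subrr.
have S2 : (a * (p.2 - s.2)%:~R + b * (q.2 - s.2)%:~R + c * (r.2 - s.2)%:~R = 0 :> R)%R.
  transitivity (a * p.2%:~R + b * q.2%:~R + c * r.2%:~R - (a + b + c) * s.2%:~R : R)%R.
    by rewrite !rmorphB /=; ring.
  by rewrite abc mul1r -E2 subrr.
have detR (u v : int * int) :
    ((det2 u v)%:~R = u.1%:~R * v.2%:~R - u.2%:~R * v.1%:~R :> R)%R.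
  by rewrite /det2 rmorphB !rmorphM.
(* Cramer's rule: the barycentric coordinates are proportional to the [D]s. *)
have bD3 : (b * D3%:~R = c * D2%:~R :> R)%R.
  apply/eqP; rewrite -subr_eq0; apply/eqP.
  transitivity ((p.1 - s.1)%:~R * 0 - (p.2 - s.2)%:~R * 0 : R)%R; last by ring.
  rewrite -[X in (_ = _ * X - _)%R]S2 -[X in (_ = _ - _ * X)%R]S1.
  by rewrite !detR /=; ring.
have aD3 : (a * D3%:~R = c * D1%:~R :> R)%R.
  apply/eqP; rewrite -subr_eq0; apply/eqP.
  transitivity (0 * (q.2 - s.2)%:~R - 0 * (q.1 - s.1)%:~R : R)%R; last by ring.
  rewrite -[X in (_ = X * _ - _)%R]S1 -[X in (_ = _ - X * _)%R]S2.
  by rewrite !detR /=; ring.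
have c_gt0 : (0 < c)%R.
  rewrite lt_neqAle c_ge0 andbT; apply/eqP => c0.
  have z (e : R) : (e * D3%:~R = 0 -> e = 0)%R.
    by move/eqP; rewrite mulf_eq0 intr_eq0 (negPf D3_neq0) orbF => /eqP.
  have b0 : b = 0%R by apply: z; rewrite bD3 -c0 mul0r.
  have a0 : a = 0%R by apply: z; rewrite aD3 -c0 mul0r.
  by move: abc; rewrite a0 b0 -c0 !addr0 => /eqP; rewrite eq_sym oner_eq0.
have sgn (D : int) (e : R) : (0 <= e)%R -> D != 0%R -> (e * D3%:~R = c * D%:~R)%R ->
    (0 < D)%R = (0 < D3)%R.
  move=> e_ge0 D_neq0 E.
  have e_gt0 : (0 < e)%R.
    rewrite lt_neqAle e_ge0 andbT; apply/eqP => e0.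
    move: E; rewrite -e0 mul0r => /esym/eqP.
    by rewrite mulf_eq0 intr_eq0 (negPf D_neq0) orbF gt_eqF.
  by rewrite -(ltr0z R D) -(pmulr_rgt0 _ c_gt0) -E (pmulr_rgt0 _ e_gt0) ltr0z.
have sgn1 := sgn _ _ a_ge0 D1_neq0 aD3; have sgn2 := sgn _ _ b_ge0 D2_neq0 bD3.
have [e eE] : exists e : int, [/\ (`|D1|%N%:Z = e * D1), (`|D2|%N%:Z = e * D2) &
    (`|D3|%N%:Z = e * D3)]%R.
  have [D3_gt0|D3_le0] := ltP 0%R D3; [exists 1%R | exists (-1)%R].
    by rewrite !mul1r !gtz0_abs ?sgn1 ?sgn2.
  have D1_le0 : (D1 <= 0)%R by rewrite leNgt sgn1 -leNgt.
  have D2_le0 : (D2 <= 0)%R by rewrite leNgt sgn2 -leNgt.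
  by rewrite !mulN1r !lez0_abs.
have gt0 (D : int) : D != 0%R -> 0 < `|D|%N by rewrite absz_gt0.
case: eE => eD1 eD2 eD3.
have [q2|q2] := eqVneq (vec s q).2 0%R; last first.
  exists s, p, q, r, `|D1|%N, `|D2|%N, `|D3|%N; split; rewrite ?eD1 ?eD2 ?eD3 //.
  - by split; apply: gt0.
  - by rewrite /D1 /D2 /D3 /det2 /vec /=; ring.
  - by rewrite /D1 /D2 /D3 /det2 /vec /=; ring.
(* Here the second vector is horizontal. As [D3] is nonzero, [vec s p] is not, so exchanging [p] and
   [q] achieves [v2.2 != 0]. *)
have D3E : D3 = (- ((vec s p).2 * (vec s q).1))%R by rewrite /D3 /det2 q2 mulr0 sub0r.
exists s, q, p, r, `|D2|%N, `|D1|%N, `|D3|%N; split; rewrite ?eD1 ?eD2 ?eD3 //.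
- by split; apply: gt0.
- by rewrite /D1 /D2 /D3 /det2 /vec /=; ring.
- by rewrite /D1 /D2 /D3 /det2 /vec /=; ring.
split; first by apply: det_neq0 => //; rewrite eq_sym.
by apply: contra D3_neq0 => /eqP p2; rewrite D3E /= p2 mul0r oppr0.
Qed.

(** * Finite subsets of the grid *)

Lemma grid_point_inj (N : nat) : injective (grid_point N).
Proof.
by move=> [i j] [i' j'] [/ord_inj -> /ord_inj ->].
Qed.

Definition grid_fset (N : nat) (S : {set 'I_N * 'I_N}) : {fset int * int} :=
  seq_fset tt [seq grid_point N y | y <- enum S].

Lemma card_grid_fset (N : nat) (S : {set 'I_N * 'I_N}) :
  #|` grid_fset N S| = #|S|.
Proof.
rewrite size_seq_fset undup_id ?size_map -?cardE //.
by rewrite (map_inj_uniq (@grid_point_inj N)) enum_uniq.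
Qed.

Lemma grid_fsetP (N : nat) (S : {set 'I_N * 'I_N}) (x : int * int) :
  reflect (exists2 y, y \in S & x = grid_point N y) (x \in grid_fset N S).
Proof.
rewrite seq_fsetE; apply: (iffP mapP) => -[y yS ->]; exists y => //.
  by rewrite mem_enum in yS.
by rewrite mem_enum.
Qed.

(** Serves the [alpha] that are bounded below: density at least 1/2 suffices for every [alpha]
    allowed, and density at most 3/4 already bounds the number of patterns, each having its interior
    point in [S]. *)
Lemma half_grid (N : nat) : 1 < N ->
  exists S : {set 'I_N * 'I_N}, N ^ 2 <= 2 * #|S| /\ 4 * #|S| <= 3 * N ^ 2.
Proof.
move=> N_gt1.
have [le_N ge_N le3_N] :
    [/\ uphalf N <= N, N <= 2 * uphalf N & 4 * uphalf N <= 3 * N].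
  by have := odd_double_half N; rewrite uphalf_half -muln2; case: (odd N) => /= E; split; lia.
exists (finset.setX [set i : 'I_N | i < uphalf N]%SET finset.setT).
rewrite cardsX cardsT card_ord -sum1dep_card -(big_ord_widen N (fun=> 1)) //.
rewrite sum1_card card_ord -mulnn; split; nia.
Qed.

(** * Numerical estimates for the choice of parameters *)

(** The right-hand side is [exp (- (ln alpha / l)^2 / 36)], and [|ln alpha| / l] is at most [m]. *)
Lemma powR_ln_ge (R : realType) (alpha l m : R) :
  (0 < alpha)%R -> (alpha < 1)%R -> (0 < l)%R -> (- ln alpha <= m * l)%R ->
  (expR (- (m ^+ 2 / 36)) <=
     alpha `^ (1 / (36 * l ^+ 2) * ln (1 / alpha)))%R.
Proof.
move=> a_gt0 a_lt1 l_gt0 le_ml.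
rewrite /powR gt_eqF // ler_expR !div1r lnV ?posrE //.
have lna_le0 : (ln alpha <= 0)%R by rewrite ln_le0 // ltW.
have -> : ((36 * l ^+ 2)^-1 * - ln alpha * ln alpha =
  - ((- ln alpha / l) ^+ 2 / 36))%R.
  by field; rewrite gt_eqF.
rewrite lerN2 ler_pM2r ?invr_gt0 // ler_sqr ?nnegrE ?divr_ge0 ?oppr_ge0 ?(ltW l_gt0) //.
  by rewrite ler_pdivrMr.
have : (0 <= m * l)%R by apply: le_trans le_ml; rewrite oppr_ge0.
by rewrite pmulr_lge0.
Qed.

(** Fixes the dimension [n] of the Behrend set: the first bound makes a density of [K^-(n+2)]
    sufficient, the second bounds [ln (1 / alpha)] by [(n + 3) ln K]. Here [n + 3] is the least
    exponent for which the product exceeds 1, and the last hypothesis makes it at least 4. *)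
Lemma exists_power_scale (R : realType) (alpha : R) (K : nat) :
  (0 < alpha)%R -> 1 < K -> (alpha * K%:R ^+ 3 <= 1)%R ->
  exists n, [/\ 0 < n, (alpha * K%:R ^+ (n + 2) <= 1)%R &
    (1 < alpha * K%:R ^+ (n + 3))%R].
Proof.
move=> a_gt0 K_gt1 aK3.
have ex : exists m, (1 < alpha * K%:R ^+ m)%R.
  exists (Num.bound (alpha^-1)); rewrite -ltr_pdivrMl // mulr1.
  have := @archi_boundP _ (alpha^-1)%R; rewrite invr_ge0 ltW // => /(_ isT)/lt_trans->//.
  by rewrite -natrX ltr_nat ltn_expl.
case: (ex_minnP ex) => m hm minm.
have m3 : 3 < m.
  rewrite ltnNge; apply/negP => m_le3; move: hm; rewrite ltNge => /negP; apply.
  apply: le_trans aK3; rewrite ler_pM2l //.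
  by rewrite -!natrX ler_nat leq_exp2l.
exists (m - 3); split; first by rewrite subn_gt0.
  rewrite leNgt; apply/negP => /minm; lia.
by rewrite subnK // ltnW.
Qed.

(** Since [4^(n n)] is the square of [2^(n n)], one of these factors and [a^n] remain to supply the
    4, which absorbs the 4 in the bound on [#|T| * L]. *)
Lemma behrend_modulus_ge (a n : nat) :
  3 <= a -> 0 < n -> 4 * 2 ^ (n * n) <= (a * 4 ^ n) ^ n.
Proof.
move=> a_ge3 n_gt0; rewrite expnMn -expnM (expnMn 2 2).
have : 3 <= a ^ n.
  by rewrite (leq_trans a_ge3) // -{1}(expn1 a) leq_pexp2l // (ltn_trans _ a_ge3).
have : 2 <= 2 ^ (n * n) by rewrite -{1}(expn1 2) leq_pexp2l // muln_gt0 n_gt0.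
by move: (2 ^ (n * n)) (a ^ n); clear; nia.
Qed.

(** * Counting dilates and the final bound *)

Local Open Scope classical_set_scope.
Local Open Scope ring_scope.

Lemma grid_fset_sub (N : nat) (S : {set 'I_N * 'I_N}) :
  [set` grid_fset N S] `<=` grid N.
Proof.
move=> x /= /grid_fsetP[y _ ->]; rewrite /grid /grid_point /=.
by rewrite !lez_nat !ltn_ord.
Qed.

Lemma dilate_sub_mem (P A : {fset int * int}) (x p : int * int) (d : int) :
  dilate x d P `<=` [set` A] -> p \in P -> shifted x d p \in A.
Proof. by move=> sub pP; apply: sub; exists p. Qed.

(** The translation by [d s] embeds [X] into the grid points of [T], which gives both finiteness and
    the bound. *)
Lemma card_dilates_le (N : nat) (P A : {fset int * int}) (d : int)
    (s : int * int) (T : {set 'I_N * 'I_N}) :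
  let X := [set x : int * int | dilate x d P `<=` [set` A]] in
  (forall x, X x -> shifted x d s \in grid_fset N T) ->
  finite_set X /\ (#|` fset_set X| <= #|T|)%N.
Proof.
move=> X XT.
pose B := seq_fset tt [seq shifted (grid_point N y) (- d) s | y <- enum T].
have XB : X `<=` [set` B].
  move=> x /XT/grid_fsetP[y yT E] /=; rewrite seq_fsetE; apply/mapP.
  exists y; first by rewrite mem_enum.
  by rewrite -E /shifted /=; case: x {E} => x1 x2 /=; congr pair; ring.
have finX : finite_set X by apply: sub_finite_set XB (finite_fset B).
split=> //; apply: (@leq_trans #|` B|).
  apply/fsubset_leq_card/fsubsetP => x; rewrite in_fset_set // inE.
  exact: XB.
by rewrite size_seq_fset (leq_trans (size_undup _)) // size_map -cardE.
Qed.

Theorem theorem4p1 (R : realType) (P : {fset int * int})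
    (hP : strictly_nonconvex R P) :
  exists c : R, 0 < c /\
    forall alpha : R, 0 < alpha -> alpha < 1 / 2 ->
      exists N0 : nat, forall N : nat, (N0 <= N)%N ->
        exists A : {fset int * int},
          [/\ [set` A] `<=` grid N,
              alpha * N%:R ^+ 2 <= #|` A|%:R
            & forall d : int, d != 0 ->
                let X := [set x : int * int | dilate x d P `<=` [set` A]] in
                finite_set X /\
                #|` fset_set X|%:R <=
                  (alpha `^ (c * ln (1 / alpha))) * N%:R ^+ 2].
Proof.
have [s [p1 [p2 [p3 [a1 [a2 [a3 /= rel]]]]]]] := strictly_nonconvex_relation R P hP.
case: rel => -[sP p1P p2P p3P] [a1_gt0 a2_gt0 a3_gt0] rel1 rel2 [det_neq0 v22_neq0].
set v1 := vec s p1 in det_neq0; set v2 := vec s p2 in det_neq0; set v3 := vec s p3.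
set a0 := (a1 + a2 + a3)%N; set K := (32 * a0)%N.
have a0_ge3 : (3 <= a0)%N by rewrite /a0; lia.
have K_gt1 : (1 < K)%N by rewrite /K; lia.
have K_gt0 : 0 < K%:R :> R by rewrite ltr0n ltnW.
set l : R := ln K%:R; have l_gt0 : 0 < l by rewrite ln_gt0 // ltr1n.
exists (1 / (36 * l ^+ 2)); split; first by rewrite divr_gt0 // mulr_gt0 // exprn_gt0.
move=> alpha alpha_gt0 alpha_lt; have alpha_lt1 : alpha < 1 by lra.
have ln_bound m : 1 < alpha * K%:R ^+ m -> - ln alpha <= m%:R * l.
  move=> h; have : 0 < ln (alpha * K%:R ^+ m) by rewrite ln_gt0.
  rewrite lnM ?posrE ?exprn_gt0 // lnXn // -/l => /ltW h'.
  by rewrite -subr_ge0 opprK addrC mulr_natl.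
have [big|small] := ltP 1 (alpha * K%:R ^+ 3).
  exists 2%N => N /half_grid[S [S_ge S_le]].
  exists (grid_fset N S); rewrite card_grid_fset; split; first exact: grid_fset_sub.
    move: S_ge; rewrite -(ler_nat R) natrM natrX => S_ge.
    by have := ler_wpM2r (sqr_ge0 (N%:R : R)) (ltW alpha_lt); lra.
  move=> d d_neq0; set X := [set x | _].
  have [finX leX] := card_dilates_le N P (grid_fset N S) d s S (fun x h => dilate_sub_mem _ _ _ _ _ h sP).
  split=> //.
  have := powR_ln_ge R alpha l 3 alpha_gt0 alpha_lt1 l_gt0 (ln_bound _ big).
  have := expR_ge1Dx (- (3 ^+ 2 / 36) : R).
  set E := _ `^ _ => e1 e2.
  have E34 : 3 / 4 <= E by lra.
  apply: (@le_trans _ _ #|S|%:R); first by rewrite ler_nat.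
  move: S_le; rewrite -(ler_nat R) -mulnn !natrM -expr2 => S_le.
  by have := ler_wpM2r (sqr_ge0 (N%:R : R)) E34; lra.
have [n [n_gt0 n_le n_gt]] := exists_power_scale R alpha K alpha_gt0 K_gt1 small.
have [Lam [Lam_big LamP]] := behrend n a1 a2 a3 n_gt0 a2_gt0.
rewrite -/a0 in Lam Lam_big LamP; set L := ((a0 * 4 ^ n) ^ n)%N in Lam Lam_big LamP.
have L_big : (4 * 2 ^ (n * n) <= L)%N by exact: behrend_modulus_ge.
have L_gt0 : (0 < L)%N by apply: leq_trans L_big; rewrite muln_gt0 expn_gt0.
set k := (a1%:Z + a3%:Z) * det2 v1 v2.
have k_neq0 : k != 0 by rewrite mulf_neq0 // -PoszD eqz_nat -lt0n addn_gt0 a1_gt0.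
have k1_neq0 : - k * v2.2 != 0 by rewrite mulf_neq0 // oppr_eq0.
have [N0 N0P] := dense_set_few_patterns a1 a2 a3 L Lam (pattern_form a1 a2 a3 v1 v2)
  v1 v2 v3 (- k * v2.2) (k * v2.1) a1_gt0 a2_gt0 L_gt0 LamP
  (fun y d => pattern_form_rel a1 a2 a3 v1 v2 v3 y d a3_gt0 rel1 rel2)
  (fun y d => pattern_form_diff a1 a2 a3 v1 v2 y d)
  k1_neq0 v22_neq0.
exists N0 => N /N0P[S [S_big SP]].
exists (grid_fset N S); rewrite card_grid_fset; split; first exact: grid_fset_sub.
  (* The density of [S] is at least [#|Lam| / (2 a0^2 L)], where [#|Lam| / L >= K^-n] and
     [2 a0^2 <= K^2]. *)
  have SK : (N ^ 2 <= #|S| * K ^ (n + 2))%N.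
    rewrite -(leq_pmul2l L_gt0).
    apply: (@leq_trans (#|Lam| * K ^ n * N ^ 2)); first by rewrite leq_mul2r Lam_big orbT.
    rewrite mulnAC; apply: (@leq_trans (#|S| * (2 * a0 ^ 2 * L) * K ^ n)).
      by rewrite leq_mul2r S_big orbT.
    rewrite expnD; have : (2 * a0 ^ 2 <= K ^ 2)%N by rewrite /K expnMn leq_mul2r orbT.
    rewrite -(leq_pmul2l L_gt0) => /(leq_mul (leqnn (#|S| * K ^ n))).
    by move: (a0 ^ 2)%N (K ^ n)%N (K ^ 2)%N #|S|; clear; lia.
  move: SK; rewrite -(ler_nat R) natrM !natrX => SK.
  apply: le_trans (ler_wpM2l (ltW alpha_gt0) SK) _.
  by rewrite mulrCA ler_piMr.
move=> d d_neq0; set X := [set x | _]; have [T [T_small TP]] := SP d d_neq0.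
have XT x : X x -> shifted x d s \in grid_fset N T.
  move=> Xx; have mem p : p \in P -> shifted x d p \in grid_fset N S by exact: dilate_sub_mem.
  (* The dilate at [x] is recentred at the image [x + d s] of the interior point, which plays the
     role of [y0]. *)
  have shiftE p : shifted x d p = shifted (shifted x d s) d (vec s p).
    by rewrite /shifted /vec /=; congr pair; ring.
  have /grid_fsetP[y0 S0 E0] := mem _ sP; have /grid_fsetP[y1 S1 E1] := mem _ p1P.
  have /grid_fsetP[y2 S2 E2] := mem _ p2P; have /grid_fsetP[y3 S3 E3] := mem _ p3P.
  apply/grid_fsetP; exists y0 => //.
  by apply: (TP y0 y1 y2 y3) => //; rewrite -?E0 -?E1 -?E2 -?E3 shiftE.
have [finX leX] := card_dilates_le N P (grid_fset N S) d s T XT.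
split=> //.
(* As [n >= 1], the exponent [n + 3] is at most [4 n]. *)
have m4n : - ln alpha <= (4 * n)%:R * l.
  apply: le_trans (ln_bound _ n_gt) _; rewrite ler_pM2r // ler_nat.
  by rewrite -[4%N]/(1 + 3)%N mulnDl mul1n leq_add2l leq_pmulr.
have := powR_ln_ge R alpha l _ alpha_gt0 alpha_lt1 l_gt0 m4n.
set E := _ `^ _ => e1.
have E2 : (2 ^+ (n * n))^-1 <= E.
  apply: le_trans e1; rewrite -exprVn.
  apply: (@le_trans _ _ (expR (- (1 / 2)) ^+ (n * n))).
    rewrite lerXn2r ?nnegrE ?expR_ge0 ?invr_ge0 //.
    by have := expR_ge1Dx (- (1 / 2) : R); lra.
  rewrite -expRM_natl ler_expR !natrM.
  by have := sqr_ge0 (n%:R : R); lra.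
have TN : (#|T| * 2 ^ (n * n) <= N ^ 2)%N.
  rewrite -(leq_pmul2l (isT : 0 < 4)%N); apply: leq_trans T_small.
  by rewrite mulnCA leq_mul2l L_big orbT.
apply: (@le_trans _ _ #|T|%:R); first by rewrite ler_nat.
apply: le_trans (ler_wpM2r (sqr_ge0 _) E2).
rewrite -ler_pdivrMl ?invr_gt0 ?exprn_gt0 // invrK mulrC.
by rewrite -!natrX -natrM ler_nat.
Qed.
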